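(* For any integer $q\geq 3$ and any $a\in[-1,1]$, $$\dim_{\mathrm{H}}(\mu_{a,q})\ \geq\ 1-\frac{1-\log 2}{\log q}-\frac{4\pi}{q\log q}-\frac{1}{\log q}\left(\frac{1}{\cos\frac{\pi}{q}}-1\right).$$
   Context: $\mathbb{T}=\mathbb{R}/\mathbb{Z}$. For a finite non-negative Borel measure $\mu$ on $\mathbb{T}$, the lower Hausdorff dimension is $$\dim_{\mathrm{H}}(\mu)=\inf\{\alpha:\ \text{there exists a Borel set } F \text{ with } \mu(F)\neq 0 \text{ and } \dim_{\mathrm{H}}F\leq\alpha\},$$ where $\dim_{\mathrm H}F$ is the Hausdorff dimension of the set $F$. For $a\in[-1,1]$ and an integer $q\geq3$, $\mu_{a,q}$ is the Riesz product $$\mu_{a,q}=\prod_{k=0}^{\infty}\bigl(1+a\cos(2\pi q^kx)\bigr),$$ i.e. the weak-$*$ limit, as $n\to\infty$, of the measures $\prod_{k=0}^{n}(1+a\cos(2\pi q^kx))\,dx$ on $\mathbb{T}$. *)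

(* Defs.v *)
From HB Require Import structures.
From mathcomp Require Import all_boot all_order all_algebra generic_quotient.
From mathcomp Require Import all_classical all_reals all_analysis.

Set Implicit Arguments.
Unset Strict Implicit.
Unset Printing Implicit Defensive.

Import Order.TTheory GRing.Theory Num.Theory.
Import numFieldNormedType.Exports.

Local Open Scope classical_set_scope.
Local Open Scope ring_scope.

Section torus.
Variable R : realType.

Definition torus_rel (x y : R) : bool := (x - y) \is a Num.int.

Lemma torus_rel_refl : reflexive torus_rel.
Proof. by move=> x; rewrite /torus_rel subrr. Qed.

Lemma torus_rel_sym : symmetric torus_rel.
Proof. by move=> x y; rewrite /torus_rel -rpredN opprB. Qed.

Lemma torus_rel_trans : transitive torus_rel.
Proof.
by move=> y x z xy yz; rewrite /torus_rel -(subrKA y) rpredD.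
Qed.

Canonical torus_equiv :=
  EquivRel torus_rel torus_rel_refl torus_rel_sym torus_rel_trans.

Definition torus : Type := {eq_quot torus_equiv}%qT.

HB.instance Definition _ := Choice.on torus.
HB.instance Definition _ := Quotient.on torus.
HB.instance Definition _ := EqQuotient.on torus.

Definition to_torus (x : R) : torus := \pi_torus%qT x.

HB.instance Definition _ := isPointed.Build torus (to_torus 0).

Definition dist_int (t : R) : R := inf [set `|t + n%:~R| | n in [set: int]].

(* The quotient metric of R / Z; it does not depend on the representatives,
   see [torus_distE]. *)
Definition torus_dist (x y : torus) : R := dist_int (repr x - repr y)%qT.

Let has_inf_dist_int (t : R) :
  has_inf [set `|t + n%:~R| | n in [set: int]].
Proof.
split; first by exists `|t + 0%:~R|, 0.
by exists 0 => _ [n _ <-].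
Qed.

Let dist_int_le t (n : int) : dist_int t <= `|t + n%:~R|.
Proof.
apply: ge_inf; last by exists n.
exact: (has_inf_dist_int t).2.
Qed.

Let dist_int_glb t c :
  (forall n : int, c <= `|t + n%:~R|) -> c <= dist_int t.
Proof.
move=> h; apply: lb_le_inf; first exact: (has_inf_dist_int t).1.
by move=> _ [n _ <-].
Qed.

Let dist_int_shift t (m : int) : dist_int (t + m%:~R) = dist_int t.
Proof.
apply/eqP; rewrite eq_le; apply/andP; split; apply: dist_int_glb => n.
- rewrite (le_trans (dist_int_le _ (n - m)))//.
  by rewrite rmorphB/= addrACA subrr addr0 -?addrA addrC.
- by rewrite -addrA -rmorphD/=; exact: dist_int_le.
Qed.

Let dist_intN t : dist_int (- t) = dist_int t.
Proof.
apply/eqP; rewrite eq_le; apply/andP; split; apply: dist_int_glb => n.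
- by rewrite (le_trans (dist_int_le _ (- n)))// rmorphN/= -opprD normrN.
- by rewrite (le_trans (dist_int_le _ (- n)))// rmorphN/= -normrN opprD opprK.
Qed.

Let dist_int_eq0 t : dist_int t = 0 -> t \is a Num.int.
Proof.
move=> t0; apply/negPn/negP => tNint.
have f0 : 0 < t - (Num.floor t)%:~R.
  rewrite lt_neqAle subr_ge0 floor_le andbT eq_sym subr_eq0.
  by apply: contra tNint => /eqP ->; rewrite intr_int.
have f1 : 0 < (Num.floor t + 1)%:~R - t.
  by rewrite subr_gt0 floorD1_gt.
have : Num.min (t - (Num.floor t)%:~R) ((Num.floor t + 1)%:~R - t)
    <= dist_int t.
  apply: dist_int_glb => n; rewrite ge_min.
  case: (leP (- n) (Num.floor t)) => nt; apply/orP; [left|right].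
  - rewrite (le_trans _ (ler_norm _))// lerD2l.
    by rewrite lerNl -rmorphN/= ler_int.
  - rewrite -normrN (le_trans _ (ler_norm _))// opprD addrC lerD2l.
    by rewrite -rmorphN/= ler_int lezD1.
by rewrite t0 leNgt lt_min f0 f1.
Qed.

Lemma torus_distE x y : torus_dist (to_torus x) (to_torus y) = dist_int (x - y).
Proof.
have reprE z : exists m : int, repr (to_torus z) = z + m%:~R.
  have : (to_torus (repr (to_torus z)) == to_torus z)%qT.
    by rewrite /to_torus reprK.
  rewrite /to_torus (@pi_eq_quot _ torus_equiv) => /intrP[m mE].
  by exists m; rewrite -mE addrC subrK.
rewrite /torus_dist; have [m ->] := reprE x; have [p ->] := reprE y.
rewrite -(dist_int_shift (x - y) (m - p)) rmorphB/=.
by rewrite opprD addrACA.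
Qed.

Let torus_distxx x : torus_dist x x = 0.
Proof.
apply/eqP; rewrite /torus_dist subrr eq_le; apply/andP; split.
  by rewrite (le_trans (dist_int_le 0 0))// add0r normr0.
by apply: dist_int_glb => n.
Qed.

Let torus_dist_eq0 x y : torus_dist x y = 0 -> x = y.
Proof.
move=> /dist_int_eq0 xy; rewrite -[x]reprK -[y]reprK; apply/eqP.
by rewrite (@pi_eq_quot _ torus_equiv).
Qed.

Let torus_dist_sym x y : torus_dist x y = torus_dist y x.
Proof. by rewrite /torus_dist -dist_intN opprB. Qed.

Let torus_dist_triangle y x z :
  torus_dist x z <= torus_dist x y + torus_dist y z.
Proof.
rewrite -lerBlDr; apply: dist_int_glb => n.
rewrite lerBlDr -lerBlDl; apply: dist_int_glb => m.
rewrite lerBlDl (le_trans (dist_int_le _ (n + m)))//.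
rewrite (le_trans _ (ler_normD _ _))// rmorphD/=.
by rewrite [in leRHS]addrACA subrKA.
Qed.

HB.instance Definition _ := isMetric.Build R torus
  torus_distxx torus_dist_eq0 torus_dist_sym torus_dist_triangle.

End torus.

Definition borel (T : ptopologicalType) := g_sigma_algebraType (@open T).

Local Open Scope ereal_scope.

Section hausdorff_dimension.
Context {R : realType} {T : metricType R}.
Implicit Types (A F : set T) (s d : R).

Definition diam A : \bar R := ereal_sup [set (mdist x y)%:E | x in A & y in A].

(* For [s = 0] the convention is that every nonempty set has gauge 1 (as given
   by [poweR]), so that the 0-dimensional measure is the counting measure. *)
Definition gauge s A : \bar R := if A == set0 then 0 else poweR (diam A) s.

Definition hausdorff_premeasure s d F : \bar R :=
  ereal_inf [set \sum_(0 <= i <oo) gauge s (C i) | C in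
    [set C : (set T)^nat |
      F `<=` \bigcup_i C i /\ forall i, diam (C i) <= d%:E]].

Definition hausdorff_measure s F : \bar R :=
  ereal_sup [set hausdorff_premeasure s d F | d in [set d | (0 < d)%R]].

Definition hausdorff_dim F : \bar R :=
  ereal_inf [set s%:E | s in
    [set s | (0 <= s)%R /\ hausdorff_measure s F = 0]].

End hausdorff_dimension.

Definition lower_hausdorff_dim (R : realType)
    (mu : {finite_measure set (borel (torus R)) -> \bar R}) : \bar R :=
  ereal_inf [set alpha%:E | alpha in [set alpha : R |
    exists F : set (borel (torus R)),
      [/\ measurable F, mu F != 0 &
          hausdorff_dim (F : set (torus R)) <= alpha%:E]]].

Definition riesz_partial (R : realType) (a : R) (q n : nat) (x : R) : R :=
  (\prod_(0 <= k < n.+1) (1 + a * cos (2 * pi * q%:R ^+ k * x)))%R.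

(* [mu] is the weak-* limit of the measures [riesz_partial a q n x dx] on the
   torus, where [dx] is the Lebesgue measure of the torus, that is the image of
   the Lebesgue measure of [0, 1[ under the quotient map. *)
Definition is_riesz_product (R : realType) (a : R) (q : nat)
    (mu : {finite_measure set (borel (torus R)) -> \bar R}) : Prop :=
  forall f : torus R -> R, continuous f ->
    (fun n => \int[lebesgue_measure]_(x in `[0%R, 1%R[)
                (f (to_torus x) * riesz_partial a q n x)%:E) @ \oo -->
    \int[mu]_x (f x)%:E.

(* Main.v *)
Require Import Defs.
From mathcomp Require Import all_boot all_order all_algebra generic_quotient ring lra.
From mathcomp Require Import all_classical all_reals all_analysis.
From mathcomp Require Import measurable_realfun.

Import Order.TTheory GRing.Theory Num.Theory.
Import numFieldNormedType.Exports.

Local Open Scope ring_scope.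

(* Write g = 1 + a cos (2 pi x), so that mu is a g-measure for x |-> q x: if v is
   continuous and the average of g v over the q preimages of every point is at
   most rho, then the integral of the product of the v (q^k x), k < n, is at most
   rho^n. With V = g + 2 pi / q, an arc of length about q^-n around x has mass at
   most 4 q^-n W_n(x), where W_n(x) is the product of the V (q^k x), k < n. Taking
   v = exp (t (ln V - b)) with t small gives rho < 1 as soon as b exceeds all the
   averages of g ln V over q preimages; then W_n < exp (n b) off a set of mass
   rho^n, and a covering argument yields the dimension bound 1 - b / ln q.
   The average of g ln V is at most that of g ln g plus 2 pi / q; by convexity in
   a, only a = 1 and a = -1 matter, and there the average of g ln g is compared
   with its integral 1 - ln 2 by cutting the Fourier series of ln (2 + 2 cos x)
   after the frequency q - 2: the products of 1 + cos x with cos (k x), 1 < k < q - 1,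
   average to zero over the q-th rotations. *)

(** * Cosine sums over rotations, the truncated Fourier series, elementary inequalities *)

Section trigonometric_averages.
Context {R : realType}.
Implicit Types x y s t u m : R.

Lemma cosDl_2piM x (n : nat) : cos (x + 2 * pi * n%:R) = cos x.
Proof.
rewrite -(periodicn (@cosD2pi R) n x); congr (cos (x + _)).
by rewrite -[pi *+ 2]mulr_natl mulr_natr.
Qed.

Lemma cosDl_2pi_int x (n : int) : cos (x + 2 * pi * n%:~R) = cos x.
Proof.
case: n => n; first exact: cosDl_2piM.
rewrite NegzE -[in RHS](subrK (2 * pi * n.+1%:R) x) cosDl_2piM.
by rewrite mulrNz mulrN.
Qed.

Lemma sinDl_2piM x (n : nat) : sin (x + 2 * pi * n%:R) = sin x.
Proof.
rewrite -(periodicn (@sinD2pi R) n x); congr (sin (x + _)).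
by rewrite -[pi *+ 2]mulr_natl mulr_natr.
Qed.

(** Multiplying by [sin b], with b = pi k / q, makes the sum telescope, and its two end terms agree
    because their arguments differ by 2 pi k. As 0 < k < q, [sin b] is nonzero and can be
    cancelled. *)
Lemma sum_cos_rotations (q k : nat) x : (0 < k < q)%N ->
  \sum_(j < q) cos (k%:R * (x + 2 * pi * (j%:R / q%:R))) = 0.
Proof.
move=> /andP[k0 kq]; have q0 : (0 < q%:R :> R) by rewrite ltr0n (leq_trans _ kq).
pose b : R := pi * k%:R / q%:R.
have sb : sin b != 0.
  apply: lt0r_neq0; apply: sin_gt0_pi; apply/andP; split.
    by rewrite /b divr_gt0 ?mulr_gt0 ?pi_gt0 ?(ltr0n _ k).
  by rewrite /b ltr_pdivrMr// ltr_pM2l ?pi_gt0// ltr_nat.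
apply: (mulfI sb); rewrite mulr0 mulr_sumr.
pose S (j : nat) := sin (k%:R * x + (2 * j%:R - 1) * b) / 2.
have stepS j : sin b * cos (k%:R * (x + 2 * pi * (j%:R / q%:R))) = S j.+1 - S j.
  rewrite /S (_ : k%:R * (x + _) = k%:R * x + 2 * j%:R * b); last by rewrite /b; ring.
  rewrite -[j.+1%:R]natr1; set w := k%:R * x + 2 * j%:R * b.
  rewrite (_ : k%:R * x + (2 * (j%:R + 1) - 1) * b = w + b); last by rewrite /w; ring.
  rewrite (_ : k%:R * x + (2 * j%:R - 1) * b = w - b); last by rewrite /w; ring.
  by rewrite sinD sinB; field.
under eq_bigr do rewrite stepS.
rewrite -(big_mkord xpredT (fun j => S j.+1 - S j)) telescope_sumr// /S.
rewrite (_ : k%:R * x + (2 * q%:R - 1) * b =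
    k%:R * x + (2 * 0%:R - 1) * b + 2 * pi * k%:R); last first.
  by rewrite /b mulr0; field; rewrite gt_eqF.
by rewrite sinDl_2piM subrr.
Qed.

(** Real part of the finite geometric sum of ratio - s exp (i x), with the denominator cleared by |1
    + s exp (i x)|^2 = 1 + 2 s cos x + s^2. The induction uses the three-term recurrence of cos (k
    x). *)
Lemma alternating_cos_sumE (K : nat) x s :
  (1 + 2 * s * cos x + s ^+ 2) *
    (\sum_(k < K) (-1) ^+ k * s ^+ k * cos (k.+1%:R * x)) =
  cos x + s - (-1) ^+ K * s ^+ K * (cos (K.+1%:R * x) + s * cos (K%:R * x)).
Proof.
elim: K => [|K IH]; first by rewrite big_ord0 mul0r cos0 ?mul1r; ring.
rewrite big_ord_recr/= mulrDr IH !exprS.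
have -> : cos (K.+2%:R * x) = 2 * cos x * cos (K.+1%:R * x) - cos (K%:R * x).
  rewrite (_ : K.+2%:R * x = K.+1%:R * x + x); last by rewrite -[K.+2%:R]natr1; ring.
  rewrite (_ : K%:R * x = K.+1%:R * x - x); last by rewrite -[K.+1%:R]natr1; ring.
  by rewrite cosB cosD; ring.
ring.
Qed.

(* The Fourier series of [ln (2 + 2 cos x)], cut after [K] terms. The weight
   [1 + cos x] makes the error uniform in [x]: with [D = 1 + 2 s cos x + s^2] it
   is bounded by the integral over [0, 1] of [4 s^K (1 + cos x) / D], and
   [D >= 2 s (1 + cos x)]. *)
Lemma weighted_ln_fourier_le (K : nat) x : (0 < K)%N ->
  (1 + cos x) * ln (1 + cos x) <=
  (1 + cos x) * (2 * \sum_(k < K) (-1) ^+ k / k.+1%:R * cos (k.+1%:R * x) - ln 2)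
  + 2 / K%:R.
Proof.
move=> K0; have K0' : (0 < K%:R :> R) by rewrite ltr0n.
have := cos_geN1 x; rewrite -subr_ge0 opprK addrC le_eqVlt => /predU1P[<-|].
  by rewrite !mul0r add0r divr_ge0.
set m := 1 + cos x => m0.
pose D s := 1 + 2 * s * cos x + s ^+ 2.
have DE s : D s = (1 - s) ^+ 2 + 2 * s * m by rewrite /D /m; ring.
have D0 s : 0 <= s -> 0 < D s.
  rewrite le_eqVlt => /predU1P[<-|s0]; first by rewrite /D; lra.
  by rewrite DE ltr_wpDl ?sqr_ge0// !mulr_gt0.
(* The logarithm, minus its truncated power series in s, minus the integrated error bound. Since f 0
   = 0 and f' <= 0, we get f 1 <= 0, which is the claim divided by m because D 1 = 2 m. *)
pose f s := ln (D s)
  - 2 * (\sum_(k < K) (-1) ^+ k / k.+1%:R * cos (k.+1%:R * x) * s ^+ k.+1)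
  - 2 / m / K%:R * s ^+ K.
pose f' s := 2 * (cos x + s) / D s
  - 2 * (\sum_(k < K) (-1) ^+ k * s ^+ k * cos (k.+1%:R * x))
  - 2 / m * s ^+ K.-1.
have df s : 0 <= s -> is_derive s 1 f (f' s).
  move=> s0.
  (* Writing f as ln of a polynomial minus a polynomial reduces its derivative to formal
     differentiation. *)
  pose pD : {poly R} := 'X^2 + (2 * cos x) *: 'X + 1.
  pose pS : {poly R} :=
    \sum_(k < K) ((-1) ^+ k / k.+1%:R * cos (k.+1%:R * x)) *: 'X^(k.+1).
  pose p : {poly R} := 2 *: pS + (2 / m / K%:R) *: 'X^K.
  have -> : f = (@ln R \o horner pD) - horner p.
    apply/funext => y; rewrite /f /D /p /pD /pS !fctE /= !hornerE horner_sum.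
    under [in RHS]eq_bigr do rewrite hornerZ hornerXn.
    by rewrite (_ : 1 + _ + _ = y ^+ 2 + 2 * cos x * y + 1); [ring|ring].
  have pDE : pD.[s] = D s by rewrite /pD !hornerE /D; ring.
  have dl : is_derive (pD.[s]) 1 (@ln R) (D s)^-1.
    by rewrite pDE; apply: is_derive1_ln; exact: D0.
  apply: (is_derive_eq (is_deriveB (is_derive1_comp dl (is_derive_poly pD s))
    (is_derive_poly p s))).
  have -> : (deriv pD).[s] = 2 * (cos x + s).
    by rewrite /pD !poly.derivE !hornerE; ring.
  have -> : (deriv p).[s] = 2 * (\sum_(k < K) (-1) ^+ k * s ^+ k * cos (k.+1%:R * x))
      + 2 / m * s ^+ K.-1.
    rewrite /p /pS !poly.derivE raddf_sum/= hornerD !hornerZ hornerMn hornerXn horner_sum.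
    congr (_ * _ + _); last by rewrite -mulr_natr; field; rewrite !gt_eqF.
    apply: eq_bigr => k _; rewrite derivZ derivXn hornerZ hornerMn hornerXn/=.
    by rewrite -mulr_natr -natr1; field; rewrite natr1 pnatr_eq0.
  by rewrite /f' opprD addrA mulrC.
(* The alternating sum identity leaves only the term in s^K, of size at most 4 s^K / D; with D >= 2
   s m this is at most 2 s^(K-1) / m, the last term of f'. *)
have f'le0 s : 0 < s < 1 -> f' s <= 0.
  move=> /andP[s0 s1]; have Ds := D0 _ (ltW s0).
  suff -> : f' s = 2 * ((-1) ^+ K * s ^+ K * (cos (K.+1%:R * x) + s * cos (K%:R * x))) /
      D s - 2 / m * s ^+ K.-1.
    have -> : s ^+ K = s * s ^+ K.-1 by rewrite -exprS prednK.
    rewrite subr_le0 ler_pdivrMr//.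
    have -> : 2 * ((-1) ^+ K * (s * s ^+ K.-1) * (cos (K.+1%:R * x) + s * cos (K%:R * x)))
       = (2 * s * ((-1) ^+ K * (cos (K.+1%:R * x) + s * cos (K%:R * x)))) * s ^+ K.-1.
      by ring.
    rewrite [leRHS]mulrAC ler_wpM2r ?exprn_ge0 ?(ltW s0)//.
    apply: (@le_trans _ _ (2 * s * 2)).
      rewrite ler_pM2l ?mulr_gt0//; apply: le_trans (ler_norm _) _.
      rewrite normrM normrX normrN1 expr1n mul1r; apply: le_trans (ler_normD _ _) _.
      rewrite normrM (ger0_norm (ltW s0)).
      have c1 := cos_max (K.+1%:R * x); have c2 := cos_max (K%:R * x).
      rewrite (_ : 2 = 1 + 1)//; apply: lerD => //.
      by apply: le_trans (ler_pM _ _ (ltW s1) c2) _; rewrite ?mulr1 ?(ltW s0).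
    rewrite [leRHS]mulrAC ler_pdivlMr// DE.
    have := sqr_ge0 (1 - s); lra.
  rewrite /f'; congr (_ - _).
  apply: (mulIf (lt0r_neq0 Ds)); rewrite mulrBl !divfK ?gt_eqF//.
  by rewrite -[2 * _ * D s]mulrA [_ * D s]mulrC /D alternating_cos_sumE; ring.
have : f 1 <= f 0.
  have cf : {within `[0, 1], continuous f}%classic.
    apply: derivable_within_continuous => s; rewrite in_itv/= => /andP[s0 _].
    by have [] := df s s0.
  apply: (@ler0_derive1_nincr _ f 0 1) => //.
  - by move=> s; rewrite in_itv/= => /andP[s0 _]; have [] := df s (ltW s0).
  - move=> s; rewrite in_itv/= => /[dup] s01 /andP[s0 _].
    by rewrite derive1E; have [_ ->] := df s (ltW s0); exact: f'le0.
have -> : f 0 = 0.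
  rewrite /f /D mulr0 mul0r expr0n/= !addr0 ln1 expr0n gtn_eqF// mulr0 subr0.
  by rewrite big1 ?mulr0 ?subr0// => k _; rewrite exprS mul0r mulr0.
rewrite /f {1}/D (_ : 1 + 2 * 1 * cos x + 1 ^+ 2 = 2 * m); last by rewrite /m; ring.
rewrite lnM ?posrE// expr1n mulr1.
under eq_bigr do rewrite expr1n mulr1.
move: (\sum_(k < K) _) => S; rewrite subr_le0 => h.
rewrite -subr_ge0.
have -> : m * (2 * S - ln 2) + 2 / K%:R - m * ln m =
    m * (2 / m / K%:R - (ln 2 + ln m - 2 * S)).
  by field; rewrite !gt_eqF.
by rewrite mulr_ge0 ?(ltW m0)// subr_ge0.
Qed.

(** The product has frequencies k, k + 1 and k + 2, all below q, so each sums to zero over the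
    rotations unless it is the frequency 0, present only for k = 0 with weight 1/2. *)
Lemma sum_weighted_cos_rotations (q k : nat) x : (k.+2 < q)%N ->
  \sum_(j < q) (1 + cos (x + 2 * pi * (j%:R / q%:R))) *
    cos (k.+1%:R * (x + 2 * pi * (j%:R / q%:R))) = (k == 0%N)%:R * (q%:R / 2).
Proof.
move=> kq.
under eq_bigr => j _.
  have -> (t : R) : (1 + cos t) * cos (k.+1%:R * t) =
      cos (k.+1%:R * t) + 2^-1 * (cos (k.+2%:R * t) + cos (k%:R * t)).
    rewrite (_ : k.+2%:R * t = k.+1%:R * t + t); last by rewrite -[k.+2%:R]natr1; ring.
    rewrite (_ : k%:R * t = k.+1%:R * t - t); last by rewrite -[k.+1%:R]natr1; ring.
    by rewrite cosB cosD; field.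
  over.
rewrite big_split/= -mulr_sumr big_split/= (sum_cos_rotations q k.+1)
  ?(sum_cos_rotations q k.+2) ?(ltnW kq)// !add0r.
case: k kq => [|k] kq; last first.
  by rewrite sum_cos_rotations ?mulr0 ?mul0r//= (ltnW (ltnW kq)).
under eq_bigr do rewrite mul0r cos0.
by rewrite sumr_const card_ord mul1r mulrC.
Qed.

(** The cut K = q - 2 is the largest for which every product with 1 + cos has frequencies below q.
    Only the first Fourier term survives; it contributes q, that is, the 1 in 1 - ln 2. *)
Lemma sum_weighted_ln_rotations_le (q : nat) x : (3 <= q)%N ->
  \sum_(j < q) (1 + cos (x + 2 * pi * (j%:R / q%:R))) *
    ln (1 + cos (x + 2 * pi * (j%:R / q%:R))) <=
  q%:R * (1 - ln 2 + 2 / (q - 2)%:R).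
Proof.
move=> q3; have q20 : (0 < q - 2)%N by rewrite subn_gt0.
apply: le_trans (ler_sum _ (fun j _ => weighted_ln_fourier_le _ _ q20)) _.
rewrite big_split/= sumr_const card_ord -[X in _ + X <= _]mulr_natl [leRHS]mulrDr lerD2r.
under eq_bigr do rewrite mulrBr.
rewrite big_split/= sumrN -mulr_suml.
have -> : \sum_(j < q) (1 + cos (x + 2 * pi * (j%:R / q%:R))) = q%:R.
  have q1 : (0 < 1 < q)%N by rewrite (leq_trans _ q3).
  rewrite big_split/= sumr_const card_ord -[RHS]addr0.
  rewrite -[X in _ = _ + X](sum_cos_rotations q 1 x q1).
  by congr (_ + _); apply: eq_bigr => j _; rewrite mul1r.
rewrite [leRHS]mulrBr lerD2r mulr1.
under eq_bigr do rewrite mulrCA mulr_sumr.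
rewrite -mulr_sumr exchange_big/=.
rewrite (eq_bigr (fun k : 'I_(q - 2) => if k == Ordinal q20 then q%:R / 2 else 0)); last first.
  move=> k _; under eq_bigr do rewrite mulrCA.
  rewrite -mulr_sumr sum_weighted_cos_rotations.
    rewrite -val_eqE/=; case: eqVneq => [->|_]; last by rewrite mul0r mulr0.
    by rewrite expr0 !mul1r invr1 mul1r.
  by have := ltn_ord k; rewrite ltn_subRL add2n.
by rewrite -big_mkcond big_pred1_eq mulrC divfK.
Qed.

(** The tangent to u ln u at the barycentre z lies below the graph, by ln (z / u) <= z / u - 1;
    averaging the tangent inequality at x and y gives the result. At u = 0 the product u ln u is
    0. *)
Lemma xlnx_convex t x y : 0 <= t <= 1 -> 0 <= x -> 0 <= y ->
  (t * x + (1 - t) * y) * ln (t * x + (1 - t) * y) <=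
  t * (x * ln x) + (1 - t) * (y * ln y).
Proof.
move=> /andP[t0 t1] x0 y0; set z := t * x + _.
have t1' : 0 <= 1 - t by rewrite subr_ge0.
have tx0 : 0 <= t * x by rewrite mulr_ge0.
have ty0 : 0 <= (1 - t) * y by rewrite mulr_ge0.
have : 0 <= z by rewrite addr_ge0.
rewrite le_eqVlt => /predU1P[z0|z0].
  have tx : t * x = 0 by rewrite /z in z0; lra.
  have ty : (1 - t) * y = 0 by rewrite /z in z0; lra.
  by rewrite -z0 !mulrA tx ty !mul0r addr0.
have tangent u : 0 <= u -> z * ln z + (1 + ln z) * (u - z) <= u * ln u.
  rewrite le_eqVlt => /predU1P[<-|u0].
    by rewrite mul0r; have := ltW z0; lra.
  have h : ln z - ln u <= z / u - 1.
    rewrite -ln_div ?posrE// -{1}[z / u](subrKC 1) le_ln1Dx//.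
    by rewrite ltrBrDl subrr divr_gt0.
  have : u * (ln z - ln u) <= u * (z / u - 1) by rewrite ler_pM2l.
  rewrite [u * (z / u - 1)]mulrBr [u * (z / u)]mulrC divfK ?gt_eqF//; lra.
have := ler_wpM2l t0 (tangent _ x0); have := ler_wpM2l t1' (tangent _ y0).
move=> h1 h2; apply: le_trans (lerD h2 h1); rewrite le_eqVlt; apply/orP; left; apply/eqP.
rewrite [in X in X * ln z]/z; move: (ln z) => l; rewrite /z; ring.
Qed.

(** exp x <= 1 / (1 - x), and (1 - x) (1 + x + 2 x^2) = 1 + x^2 (1 - 2 x) >= 1. *)
Lemma expR_le_quadratic x : x <= 2^-1 -> expR x <= 1 + x + 2 * x ^+ 2.
Proof.
move=> x2; have x1 : 0 < 1 - x by lra.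
rewrite -[x in expR x]opprK expRN -[leRHS]invrK lef_pV2 ?posrE ?expR_gt0//; last first.
  by rewrite invr_gt0; nra.
apply: le_trans (expR_ge1Dx (- x)).
rewrite -[leRHS]invrK lef_pV2 ?posrE ?invr_gt0//; last by nra.
rewrite -[leLHS]mul1r ler_pdivrMr//; nra.
Qed.

Lemma cos_lipschitz x y : `|cos x - cos y| <= `|x - y|.
Proof.
wlog xy : x y / x <= y => [h|].
  by have [/h//|/ltW/h] := leP x y; rewrite distrC [`|y - x|]distrC.
have [|c _] := @MVT_segment _ (@cos R) (fun x => - sin x) x y xy.
  by apply: derivable_within_continuous => z _; exact: derivable_cos.
rewrite distrC => ->; rewrite normrM normrN [leRHS]distrC.
by rewrite -[leRHS]mul1r ler_wpM2r// sin_max.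
Qed.

End trigonometric_averages.

(** * The Riesz factor and its averages over preimages *)

Definition riesz_factor {R : realType} (a x : R) : R := 1 + a * cos (2 * pi * x).

Section riesz_factor.
Context {R : realType} (a : R).
Hypothesis a1 : -1 <= a <= 1.
Implicit Types x y b t : R.

Local Notation g := (riesz_factor a).

Lemma riesz_factor_bounds x : 0 <= g x <= 2.
Proof.
have := cos_geN1 (2 * pi * x); have := cos_le1 (2 * pi * x).
by rewrite /riesz_factor; move: a1 => /andP[]; nra.
Qed.

Lemma riesz_factor_int x (n : int) : g (x + n%:~R) = g x.
Proof. by rewrite /riesz_factor mulrDr cosDl_2pi_int. Qed.

Lemma continuous_riesz_factor : continuous g.
Proof.
move=> x; apply: cvgD; first exact: cvg_cst.
apply: cvgMr; apply: (@continuous_comp _ _ _ (fun x => 2 * pi * x) cos).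
  exact: mulrl_continuous.
exact: continuous_cos.
Qed.

Lemma riesz_factor_lipschitz x y : `|g x - g y| <= 2 * pi * `|x - y|.
Proof.
rewrite /riesz_factor opprD addrACA subrr add0r -mulrBr normrM.
have a1' : `|a| <= 1 by rewrite ler_norml.
apply: le_trans (ler_pM _ _ a1' (cos_lipschitz _ _)) _ => //.
by rewrite mul1r -mulrBr normrM (gtr0_norm (_ : 0 < 2 * pi))// mulr_gt0// pi_gt0.
Qed.

(** The preimages (y + j) / q of y under x |-> q x are q-th rotations of a single angle, so the
    rotation sums above apply to them. *)
Lemma riesz_factor_rotation (q : nat) y (j : nat) :
  g ((y + j%:R) / q%:R) = 1 + a * cos (2 * pi * (y / q%:R) + 2 * pi * (j%:R / q%:R)).
Proof. by rewrite /riesz_factor -mulrDr -mulrDl. Qed.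

Lemma sum_riesz_factor (q : nat) y : (1 < q)%N ->
  \sum_(j < q) g ((y + j%:R) / q%:R) = q%:R.
Proof.
move=> q1; rewrite big_split/= sumr_const card_ord -mulr_sumr.
rewrite (_ : \sum_(j < q) _ = 0) ?mulr0 ?addr0//.
rewrite -[RHS](sum_cos_rotations q 1 (2 * pi * (y / q%:R)))//.
by apply: eq_bigr => j _; rewrite mul1r -mulrDr -mulrDl.
Qed.

(** First, ln (1 + d / u) <= d / u gives u ln (u + d) <= u ln u + d. Then 1 + a w is the mixture of
    1 + w and 1 - w with weights (1 + a) / 2 and (1 - a) / 2; convexity reduces to these two, and 1
    - w is 1 + cos at the angle shifted by pi. *)
Lemma sum_riesz_factor_ln_le (q : nat) y d : (3 <= q)%N -> 0 < d ->
  \sum_(j < q) g ((y + j%:R) / q%:R) * ln (g ((y + j%:R) / q%:R) + d) <=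
  q%:R * (1 - ln 2 + 2 / (q - 2)%:R + d).
Proof.
move=> q3 d0; have q1 := leq_trans (isT : 1 < 3)%N q3.
apply: (@le_trans _ _
    (\sum_(j < q) (g ((y + j%:R) / q%:R) * ln (g ((y + j%:R) / q%:R)) + d))).
  apply: ler_sum => j _.
  have /andP[+ _] := riesz_factor_bounds ((y + j%:R) / q%:R).
  move: (g _) => u; rewrite le_eqVlt => /predU1P[<-|u0]; first by rewrite !mul0r add0r ltW.
  have -> : u + d = u * (1 + d / u) by rewrite mulrDr mulr1 mulrC divfK ?gt_eqF.
  have du0 : 0 < d / u by rewrite divr_gt0.
  rewrite lnM ?posrE ?addr_gt0// mulrDr lerD2l.
  rewrite -[leRHS](divfK (lt0r_neq0 u0)) mulrC ler_pM2r//.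
  by rewrite le_ln1Dx// (lt_trans _ du0)// oppr_lt0.
rewrite big_split/= sumr_const card_ord -[X in _ + X <= _]mulr_natl [leRHS]mulrDr lerD2r.
pose tt := (1 + a) / 2.
have tt01 : 0 <= tt <= 1 by move: a1; rewrite /tt; lra.
pose x0 := 2 * pi * (y / q%:R).
pose m x := \sum_(j < q) (1 + cos (x + 2 * pi * (j%:R / q%:R))) *
    ln (1 + cos (x + 2 * pi * (j%:R / q%:R))).
apply: (@le_trans _ _ (tt * m x0 + (1 - tt) * m (x0 + pi))).
  rewrite !mulr_sumr -big_split/=; apply: ler_sum => j _.
  rewrite addrAC cosDpi riesz_factor_rotation -/x0.
  have := cos_geN1 (x0 + 2 * pi * (j%:R / q%:R)).
  have := cos_le1 (x0 + 2 * pi * (j%:R / q%:R)).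
  move: (cos _) => w w1 w2.
  have -> : 1 + a * w = tt * (1 + w) + (1 - tt) * (1 + - w) by rewrite /tt; field.
  by apply: xlnx_convex => //; lra.
have h x : m x <= q%:R * (1 - ln 2 + 2 / (q - 2)%:R).
  exact: sum_weighted_ln_rotations_le.
have := h x0; have := h (x0 + pi); have /andP[] := tt01; nra.
Qed.

(** Second-order expansion of the exponential: the weights g average to 1, so the average is at most
    1 - t (b - c) + 2 t^2 L^2, where L bounds |ln (g + d) - b|. The shift d > 0 keeps this logarithm
    bounded where g vanishes. *)
Lemma riesz_factor_laplace (q : nat) d b : (3 <= q)%N -> 0 < d ->
  1 - ln 2 + 2 / (q - 2)%:R + d < b ->
  exists t rho, [/\ 0 < t, rho < 1 & forall y,
    q%:R^-1 * (\sum_(j < q) g ((y + j%:R) / q%:R) *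
      expR (t * (ln (g ((y + j%:R) / q%:R) + d) - b))) <= rho].
Proof.
move=> q3 d0; set c := 1 - _ + _ + _ => cb.
have q1 := leq_trans (isT : 1 < 3)%N q3.
have q0 : 0 < q%:R :> R by rewrite ltr0n (ltnW q1).
pose L := `|ln d| + `|ln (2 + d)| + `|b| + 1.
have L0 : 0 < L by rewrite ltr_wpDl ?addr_ge0.
(* The first bound keeps the exponent below 1/2, as [expR_le_quadratic] requires; the second lets
   the quadratic term consume at most half of the gain t (b - c). *)
pose t := Num.min (2 * L)^-1 ((b - c) / (4 * L ^+ 2)).
have bc0 : 0 < b - c by rewrite subr_gt0.
have t0 : 0 < t by rewrite lt_min invr_gt0 divr_gt0 ?mulr_gt0 ?exprn_gt0.
have tL : t * L <= 2^-1.
  have : t <= (2 * L)^-1 by rewrite ge_min lexx.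
  move=> /(ler_wpM2r (ltW L0)); rewrite (_ : (2 * L)^-1 * L = 2^-1)//.
  by field; rewrite gt_eqF.
have tL2 : 2 * t * L ^+ 2 <= (b - c) / 2.
  have : t <= (b - c) / (4 * L ^+ 2) by rewrite ge_min lexx orbT.
  rewrite ler_pdivlMr ?mulr_gt0 ?exprn_gt0//; lra.
exists t, (1 - t * ((b - c) / 2)); split => //.
  by rewrite ltrBlDl ltrDr mulr_gt0 ?divr_gt0.
move=> y; rewrite -(ler_pM2l q0) mulVKf ?gt_eqF//.
pose u (j : 'I_q) := ln (g ((y + j%:R) / q%:R) + d) - b.
have uL j : `|u j| <= L.
  have /andP[g0 g2] := riesz_factor_bounds ((y + j%:R) / q%:R).
  have h1 : ln d <= ln (g ((y + j%:R) / q%:R) + d).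
    by rewrite ler_ln ?posrE ?lerDr// ltr_wpDl.
  have h2 : ln (g ((y + j%:R) / q%:R) + d) <= ln (2 + d).
    by rewrite ler_ln ?posrE ?lerD2r// ?ltr_wpDl// ltrDl.
  have := ler_norm (ln (2 + d)); have := ler_norm (- ln d); rewrite normrN.
  have := ler_norm b; have := ler_norm (- b); rewrite normrN.
  rewrite /u ler_norml /L; have := normr_ge0 (ln d); have := normr_ge0 (ln (2 + d)).
  have := normr_ge0 b.
  by move=> *; apply/andP; split; lra.
apply: (@le_trans _ _
    (\sum_(j < q) (g ((y + j%:R) / q%:R) * (1 + 2 * t ^+ 2 * L ^+ 2 - t * b) +
       t * (g ((y + j%:R) / q%:R) * ln (g ((y + j%:R) / q%:R) + d))))).
  apply: ler_sum => j _; have /andP[g0 g2] := riesz_factor_bounds ((y + j%:R) / q%:R).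
  rewrite [t * (_ * _)]mulrCA -mulrDr ler_wpM2l//.
  have tu : `|t * u j| <= t * L by rewrite normrM (gtr0_norm t0) ler_pM2l.
  apply: le_trans (expR_le_quadratic _ _) _.
    by apply: le_trans (ler_norm _) (le_trans tu tL).
  rewrite -/(u j) -real_normK ?num_real//.
  have : `|t * u j| ^+ 2 <= (t * L) ^+ 2.
    by rewrite lerXn2r ?nnegrE// mulr_ge0 ?ltW.
  rewrite exprMn /u; nra.
rewrite big_split/= -mulr_suml -mulr_sumr sum_riesz_factor//.
have := sum_riesz_factor_ln_le _ y _ q3 d0; rewrite -/c => h.
apply: (@le_trans _ _ (q%:R * (1 + 2 * t ^+ 2 * L ^+ 2 - t * b) + t * (q%:R * c))).
  by rewrite lerD2l ler_pM2l.
rewrite [t * (_ * c)]mulrCA -mulrDr ler_pM2l//.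
have := ler_wpM2l (ltW t0) tL2; lra.
Qed.

End riesz_factor.

(** * Integration against the transfer operator of x |-> Q x *)

Section transfer.
Context {R : realType}.
Implicit Types f h v : R -> R.
Local Notation mu := (@lebesgue_measure R).

Lemma measurable_EFin_continuous f (D : set R) : continuous f ->
  measurable_fun D (fun x => (f x)%:E).
Proof.
move=> cf; apply/measurable_EFinP; apply: measurable_funTS.
exact: continuous_measurable_fun.
Qed.

Lemma continuous_affine (c d : R) : continuous (fun y : R => (y + c) * d).
Proof.
by move=> y; apply: cvgM; [apply: cvgD; [exact: cvg_id|exact: cvg_cst]|exact: cvg_cst].
Qed.

Lemma integral_affine f (c d : R) : 0 < d -> continuous f ->
  (\int[mu]_(x in `[(c * d)%R, ((1 + c) * d)%R[) (f x)%:E =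
   \int[mu]_(y in `[0%R, 1%R[) (f ((y + c) * d) * d)%:E)%E.
Proof.
move=> d0 cf; pose F (y : R) := (y + c) * d.
have cF : continuous F by exact: continuous_affine.
have FE : F = horner (d *: ('X + c%:P)).
  by apply/funext => y; rewrite /F hornerZ hornerD hornerX hornerC mulrC.
have dF (y : R) : is_derive y 1 F d.
  rewrite FE; apply: (is_derive_eq (is_derive_poly _ _)).
  by rewrite derivZ derivD derivX derivC addr0 hornerZ hornerC mulr1.
have F'E : (F^`())%classic = cst d.
  by apply/funext => y; rewrite derive1E; have [_ ->] := dF y.
rewrite !integral_itv_bndo_bndc; first last.
- exact: measurable_EFin_continuous.
- apply: measurable_EFin_continuous => y; apply: cvgM; last exact: cvg_cst.
  apply: (@continuous_comp _ _ _ F f); [exact: cF|exact: cf].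
rewrite (_ : c * d = F 0); last by rewrite /F add0r.
rewrite (@integration_by_substitution_increasing R F f 0 1)//; last first.
- by apply: continuous_subspaceT.
- split; first by move=> y _; have [] := dF y.
  + by apply: cvg_at_right_filter; exact: cF.
  + by apply: cvg_at_left_filter; exact: cF.
- by rewrite F'E; exact: is_cvg_cst.
- by rewrite F'E; exact: is_cvg_cst.
- by rewrite F'E => y _; exact: cvg_cst.
- by move=> x y _ _ xy; rewrite /F ltr_pM2r// ltrD2r.
by rewrite F'E.
Qed.

(** Cut [0, 1[ into the Q intervals [j / Q, (j + 1) / Q[ and rescale each to [0, 1[. *)
Lemma integral_transfer f (Q : nat) : (0 < Q)%N -> continuous f -> (forall x, 0 <= f x) ->
  (\int[mu]_(x in `[0%R, 1%R[) (f x)%:E =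
   \int[mu]_(y in `[0%R, 1%R[) (Q%:R^-1 * \sum_(j < Q) f ((y + j%:R) / Q%:R))%:E)%E.
Proof.
move=> Q0 cf f0; have Q0' : 0 < Q%:R :> R by rewrite ltr0n.
have cfa (j : nat) : continuous (fun y : R => f ((y + j%:R) / Q%:R) / Q%:R).
  move=> y; apply: cvgM; last exact: cvg_cst.
  by apply: (@continuous_comp _ _ _ (fun y : R => (y + j%:R) / Q%:R) f);
    [exact: continuous_affine|exact: cf].
have step (j : nat) : (\int[mu]_(x in `[0%R, (j%:R / Q%:R)%R[) (f x)%:E =
   \sum_(i < j) \int[mu]_(y in `[0%R, 1%R[) (f ((y + i%:R) / Q%:R) / Q%:R)%:E)%E.
  elim: j => [|j IH].
    by rewrite mul0r big_ord0 set_itvco0 integral_set0.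
  rewrite big_ord_recr/= -IH -integral_affine ?invr_gt0//.
  rewrite -[j.+1%:R]natr1 [j%:R + 1]addrC.
  rewrite (@itv_bndbnd_setU _ _ _ (BLeft (j%:R / Q%:R))); last 2 first.
  - by rewrite bnd_simp divr_ge0.
  - by rewrite bnd_simp ler_pM2r ?invr_gt0// lerDr.
  rewrite ge0_integral_setU//=.
  - exact: measurable_EFin_continuous.
  - by move=> x _; rewrite lee_fin.
  - apply/disj_setPS => y [/=]; rewrite 2!in_itv/= => /andP[_ yx] /andP[].
    by rewrite leNgt yx.
have := step Q; rewrite divff ?gt_eqF// => ->.
pose F (i : 'I_Q) (y : R) := (f ((y + i%:R) / Q%:R) / Q%:R)%:E.
transitivity (\int[mu]_(y in `[0%R, 1%R[) \sum_(i < Q) F i y)%E.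
  rewrite ge0_integral_sum// => [i|i y _].
    by apply: measurable_EFin_continuous; exact: cfa.
  by rewrite lee_fin divr_ge0.
by apply: eq_integral => y _; rewrite sumEFin -mulr_suml mulrC.
Qed.

(* The averages of [v] are its image under the transfer operator of x |-> Q x. *)
Lemma integral_transfer_le v h (Q : nat) (r : R) : (0 < Q)%N ->
  continuous v -> continuous h -> (forall x, 0 <= v x) -> (forall x, 0 <= h x) ->
  (forall x (n : int), h (x + n%:~R) = h x) ->
  (forall y, Q%:R^-1 * \sum_(j < Q) v ((y + j%:R) / Q%:R) <= r) ->
  (\int[mu]_(x in `[0%R, 1%R[) (v x * h (Q%:R * x))%:E <=
   r%:E * \int[mu]_(x in `[0%R, 1%R[) (h x)%:E)%E.
Proof.
move=> Q0 cv ch v0 h0 hper vr; have Q0' : Q%:R != 0 :> R by rewrite pnatr_eq0 -lt0n.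
have r0 : 0 <= r.
  by apply: le_trans (vr 0); rewrite mulr_ge0 ?invr_ge0// sumr_ge0.
have chQ : continuous (fun x : R => h (Q%:R * x)).
  by move=> x; apply: (@continuous_comp _ _ _ (fun x : R => Q%:R * x) h);
    [exact: mulrl_continuous|exact: ch].
rewrite (@integral_transfer (fun x => v x * h (Q%:R * x)) Q)//; last 2 first.
- by move=> x; apply: cvgM; [exact: cv|exact: chQ].
- by move=> x; rewrite mulr_ge0.
rewrite -ge0_integralZl_EFin//; last 2 first.
- by move=> x _; rewrite lee_fin.
- exact: measurable_EFin_continuous.
apply: ge0_le_integral => //.
- by move=> y _; rewrite lee_fin mulr_ge0 ?invr_ge0// sumr_ge0// => j _; rewrite mulr_ge0.
- apply/measurable_EFinP; apply: measurable_funM; first exact: measurable_cst.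
  apply: measurable_sum => j; apply/measurable_EFinP; apply: measurable_EFin_continuous.
  move=> y; apply: (@continuous_comp _ _ _ (fun y : R => (y + j%:R) / Q%:R)
    (fun x => v x * h (Q%:R * x))).
    exact: continuous_affine.
  by apply: cvgM; [exact: cv|exact: chQ].
- by apply: measurable_funeM; exact: measurable_EFin_continuous.
- move=> y _; rewrite -EFinM lee_fin.
  under eq_bigr => j _.
    rewrite [Q%:R * _]mulrC divfK// (hper y j). over.
  by rewrite -mulr_suml mulrA ler_wpM2r.
Qed.

End transfer.

(** * Multiplicative cocycles over x |-> q x *)

(** For v = g these are the densities of the partial Riesz products. A general v also covers the
    weights V = g + 2 pi / q and exp (t (ln V - b)). *)
Definition orbit_prod {R : realType} (v : R -> R) (q n : nat) (x : R) : R :=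
  \prod_(k < n) v (q%:R ^+ k * x).

Section orbit_prod.
Context {R : realType}.
Local Notation leb := (@lebesgue_measure R).
Implicit Types v w g : R -> R.

Lemma orbit_prodS v (q n : nat) x :
  orbit_prod v q n.+1 x = v x * orbit_prod v q n (q%:R * x).
Proof.
rewrite /orbit_prod big_ord_recl expr0 mul1r; congr (_ * _).
by apply: eq_bigr => k _; rewrite /bump/= exprS mulrA [q%:R * _]mulrC.
Qed.

Lemma orbit_prodD v (q n m : nat) x :
  orbit_prod v q (n + m) x = orbit_prod v q n x * orbit_prod v q m ((q ^ n)%:R * x).
Proof.
elim: n x => [|n IH] x; first by rewrite {2}/orbit_prod big_ord0 expn0 !mul1r.
rewrite addSn !orbit_prodS IH -mulrA; congr (_ * (_ * orbit_prod _ _ _ _)).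
by rewrite expnS natrM; ring.
Qed.

Lemma orbit_prod_ge0 v (q n : nat) x : (forall y, 0 <= v y) -> 0 <= orbit_prod v q n x.
Proof. by move=> v0; apply: prodr_ge0. Qed.

Lemma continuous_orbit_prod v (q n : nat) : continuous v -> continuous (orbit_prod v q n).
Proof.
move=> cv; elim: n => [|n IH].
  rewrite (_ : orbit_prod v q 0 = cst 1) => [x|]; first exact: cvg_cst.
  by apply/funext => x; rewrite /orbit_prod big_ord0.
rewrite (_ : orbit_prod v q n.+1 = fun x => v x * orbit_prod v q n (q%:R * x)) => [x|].
  apply: cvgM; first exact: cv.
  apply: (@continuous_comp _ _ _ (fun x : R => q%:R * x) (orbit_prod v q n)).
    exact: mulrl_continuous.
  exact: IH.
by apply/funext => x; rewrite orbit_prodS.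
Qed.

Lemma orbit_prod_int v (q n : nat) x (m : int) :
  (forall y (k : int), v (y + k%:~R) = v y) ->
  orbit_prod v q n (x + m%:~R) = orbit_prod v q n x.
Proof.
move=> vper; apply: eq_bigr => k _.
by rewrite mulrDr -natrX -[X in _ + X](_ : (Posz (q ^ k)%N * m)%:~R = _) ?vper// intrM.
Qed.

(** Peel off the first factor v g: what remains is a periodic function of q x, so the transfer
    inequality costs one factor r. The N extra factors of g make the bound usable for all later
    partial products. *)
Lemma integral_orbit_prod_le v g (q n N : nat) (r : R) : (0 < q)%N ->
  continuous v -> continuous g -> (forall x, 0 <= v x) -> (forall x, 0 <= g x) ->
  (forall x (m : int), v (x + m%:~R) = v x) ->
  (forall x (m : int), g (x + m%:~R) = g x) ->
  (forall y, q%:R^-1 * \sum_(j < q) g ((y + j%:R) / q%:R) * v ((y + j%:R) / q%:R) <= r) ->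
  (\int[leb]_(x in `[0%R, 1%R[) (orbit_prod v q n x * orbit_prod g q (n + N) x)%:E <=
   (r ^+ n)%:E * \int[leb]_(x in `[0%R, 1%R[) (orbit_prod g q N x)%:E)%E.
Proof.
move=> q0 cv cg v0 g0 vper gper avg.
have r0 : 0 <= r.
  apply: le_trans (avg 0); rewrite mulr_ge0 ?invr_ge0// sumr_ge0// => j _.
  by rewrite mulr_ge0.
elim: n => [|n IH].
  by under eq_integral do rewrite /orbit_prod big_ord0 mul1r; rewrite mul1e.
under eq_integral do rewrite addSn !orbit_prodS mulrACA.
pose vg x := orbit_prod v q n x * orbit_prod g q (n + N) x.
apply: (@le_trans _ _ (r%:E * \int[leb]_(x in `[0%R, 1%R[) (vg x)%:E)%E).
  apply: (@integral_transfer_le _ (fun x => v x * g x) vg) => //.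
  - by move=> x; apply: cvgM; [exact: cv|exact: cg].
  - by move=> x; apply: cvgM; exact: continuous_orbit_prod.
  - by move=> x; rewrite mulr_ge0.
  - by move=> x; rewrite mulr_ge0 ?orbit_prod_ge0.
  - by move=> x m; rewrite /vg !orbit_prod_int.
  - by move=> y; under eq_bigr do rewrite mulrC.
by rewrite exprS EFinM -muleA lee_wpmul2l ?lee_fin.
Qed.

End orbit_prod.

(** * Continuity on the torus *)

Section torus_topology.
Context {R : realType}.
Local Notation torus := (torus R).
Implicit Types (x y t r : R) (F : torus -> R).

Lemma dist_int_le t (n : int) : dist_int t <= `|t + n%:~R|.
Proof.
by apply: ge_inf; [exists 0 => _ [m _ <-]|exists n]. Qed.

Lemma dist_int_lt t r : dist_int t < r -> exists n : int, `|t + n%:~R| < r.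
Proof.
move=> tr; have ne0 : ([set `|t + n%:~R| | n in [set: int]] !=set0)%classic.
  by exists `|t + 0%:~R|, 0.
by have [_ [n _ <-] tn] := inf_lt ne0 tr; exists n.
Qed.

Lemma to_torus_repr (z : torus) : to_torus (repr z)%qT = z.
Proof. exact: reprK. Qed.

Lemma mdist_to_torus x y : mdist (to_torus x) (to_torus y) = dist_int (x - y).
Proof. exact: torus_distE. Qed.

Lemma repr_to_torus x : exists n : int, repr (to_torus x)%qT = x + n%:~R.
Proof.
have : (to_torus (repr (to_torus x)) == to_torus x)%qT by rewrite to_torus_repr.
rewrite /to_torus (@pi_eq_quot _ (torus_equiv R)) => /intrP[m mE].
by exists m; rewrite -mE addrC subrK.
Qed.

Lemma continuous_to_torus : continuous (@to_torus R).
Proof.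
move=> x; apply/metricType_numDomainType.cvgrPdist_lt => e e0.
near=> y; rewrite mdist_to_torus.
apply: le_lt_trans (dist_int_le _ 0) _; rewrite addr0.
by near: y; apply: cvgr_dist_lt.
Unshelve. all: by end_near. Qed.

(** A point of the torus near the class of x has a representative near x: the one shifted by the
    integer that nearly realises the quotient distance. *)
Lemma continuous_torus F : continuous (F \o @to_torus R) -> continuous F.
Proof.
move=> cF z; rewrite -[z]to_torus_repr; move: (repr z) => x.
apply/(cvgrPdist_lt (FF := @nbhs_filter torus _)) => e e0.
have /cvgrPdist_lt/(_ e e0)/nbhs_ballP[d /= d0 dF] := cF x.
apply/metricType_numDomainType.nbhs_mdistP; exists d => //= w.
rewrite -[w]to_torus_repr; move: (repr w) => y /=.
rewrite mdist_to_torus => /dist_int_lt[n xyn].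
have yE : to_torus y = to_torus (y - n%:~R).
  apply: mdist_positivity; rewrite mdist_to_torus; apply/eqP; rewrite eq_le.
  apply/andP; split.
    apply: le_trans (dist_int_le _ (- n)) _.
    by rewrite rmorphN/= (_ : _ + _ = 0) ?normr0//; ring.
  by rewrite -mdist_to_torus mdist_ge0.
rewrite yE; apply: dF; rewrite /ball/=.
by rewrite opprB addrA addrAC.
Qed.

(** The choice of representatives [repr] need not be continuous; periodicity of v makes it
    invisible. *)
Lemma continuous_lift (v : R -> R) : continuous v ->
  (forall x (n : int), v (x + n%:~R) = v x) ->
  continuous (fun z : torus => v (repr z)%qT).
Proof.
move=> cv vper; apply: continuous_torus.
rewrite (_ : _ \o _ = v)//; apply/funext => x /=.
by have [n ->] := repr_to_torus x; rewrite vper.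
Qed.

End torus_topology.

(** * Measurability, tent functions and counting of grid points *)

Lemma continuous_measurable_borel {R : realType} {T : ptopologicalType} (F : T -> R) :
  continuous F -> measurable_fun setT (F : borel T -> R).
Proof.
move=> /continuousP cF; apply: (measurability _ (RGenOpens.measurableE R)).
move=> _ [_ [a [b ->]] <-]; rewrite setTI; apply: sub_sigma_algebra.
by apply: cF; exact: interval_open.
Qed.

Lemma measurable_continuous_sublevel {R : realType} {T : ptopologicalType}
    (f : T -> R) (c : R) :
  continuous f -> measurable ([set z | f z <= c]%classic : set (borel T)).
Proof.
move=> cf; have := continuous_measurable_borel f cf measurableT
  `]-oo, c]%classic (measurable_itv _).
by rewrite setTI; congr measurable; apply/seteqP; split => z /=; rewrite in_itv.
Qed.

(** Markov's inequality at level 1. *)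
Lemma measure_le_integral {d : measure_display} {T : measurableType d} {R : realType}
    (mu : {measure set T -> \bar R}) (f : T -> R) (B : set T) :
  measurable B -> measurable_fun setT f -> (forall x, 0 <= f x) ->
  (forall x, B x -> 1 <= f x) -> (mu B <= \int[mu]_x (f x)%:E)%E.
Proof.
move=> mB mf f0 fB; rewrite -[leLHS]mul1e -(integral_cst mu mB 1%E).
rewrite integral_mkcond; apply: ge0_le_integral => //.
- by move=> x _; rewrite /patch; case: ifP.
- by apply/(measurable_restrictT _ _).1 => //; exact: measurable_cst.
- exact/measurable_EFinP.
move=> x _; rewrite /patch; case: ifPn => [|_]; last by rewrite lee_fin.
by rewrite inE lee_fin => /fB.
Qed.

Lemma continuous_mdist {R : realType} {T : metricType R} (p : T) :
  continuous (mdist p : T -> R).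
Proof.
move=> z; apply/(cvgrPdist_lt (FF := @nbhs_filter T _)) => e e0.
apply/metricType_numDomainType.nbhs_mdistP; exists e => //= w zw.
apply: le_lt_trans zw; rewrite ler_norml; apply/andP; split.
  by rewrite lerNl opprB lerBlDl metric_triangle.
by rewrite lerBlDl (metric_sym z w) metric_triangle.
Qed.

Lemma continuous_tent {R : realType} {T : metricType R} (p : T) (c d : R) :
  continuous (fun z : T => Num.max 0 (c - d * mdist p z)).
Proof.
apply: max_fun_continuous => z; first exact: cvg_cst.
apply: cvgB; first exact: cvg_cst.
by apply: cvgMr; exact: continuous_mdist.
Qed.

Lemma sum_residue (R : realType) (Q : nat) (u : int) : (0 < Q)%N ->
  \sum_(j < Q) (Posz j == (u %% Q)%Z)%:R = 1 :> R.
Proof.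
move=> Q0; have Q0' : Posz Q != 0 by rewrite eqz_nat -lt0n.
have kQ : (absz (u %% Q)%Z < Q)%N by rewrite -ltz_nat gez0_abs ?modz_ge0// ltz_mod.
have kE : (u %% Q)%Z = Posz (Ordinal kQ) by rewrite /= gez0_abs ?modz_ge0.
rewrite kE (bigD1 (Ordinal kQ))//= eqxx big1 ?addr0// => j jk.
by rewrite eqz_nat (negbTE (_ : j != Ordinal kQ :> nat)).
Qed.

(** After scaling by Q, closeness says that some integer z congruent to j modulo Q is at distance
    less than 1 from Q x - y; hence z is the floor of that number or its successor. *)
Lemma dist_int_grid (R : realType) (Q j : nat) (x y : R) : (j < Q)%N ->
  dist_int (x - (y + j%:R) / Q%:R) < Q%:R^-1 ->
  (Posz j == (Num.floor (Q%:R * x - y) %% Q)%Z) ||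
  (Posz j == ((Num.floor (Q%:R * x - y) + 1) %% Q)%Z).
Proof.
move=> jQ h; set u := Num.floor (Q%:R * x - y); have [m xm] := dist_int_lt _ _ h.
have Q0 : 0 < Q%:R :> R by rewrite ltr0n (leq_trans _ jQ).
pose z := Posz j - Posz Q * m.
have : `|Q%:R * x - y - z%:~R| < 1.
  rewrite -(ltr_pM2l Q0) mulfV ?gt_eqF// in xm.
  rewrite -{1}(gtr0_norm Q0) -normrM in xm.
  rewrite (_ : _ - _ = Q%:R * (x - (y + j%:R) / Q%:R + m%:~R))//.
  by rewrite /z rmorphB/= rmorphM/=; field; rewrite gt_eqF.
rewrite ltr_norml => /andP[h1 h2].
have := floor_le (Q%:R * x - y); have := floorD1_gt (Q%:R * x - y); rewrite -/u => h3 h4.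
have zu : u <= z.
  rewrite -ltzD1 -(ltr_int R) rmorphD/=; lra.
have zu1 : z <= u + 1.
  rewrite -ltzD1 -(ltr_int R).
  rewrite (_ : (u + 1 + 1)%:~R = u%:~R + 1 + 1 :> R); last by rewrite !rmorphD.
  rewrite rmorphD/= in h3; lra.
have jz : Posz j = (z %% Q)%Z.
  rewrite /z -modzDmr -mulrN modzMr addr0 modz_small//.
move: zu; rewrite le_eqVlt => /predU1P[->|uz]; first by rewrite -jz eqxx.
have -> : u + 1 = z by apply/eqP; rewrite eq_le zu1 andbT lezD1.
by rewrite -jz eqxx orbT.
Qed.

(** * Integrals and masses of arcs for the Riesz product *)

Section riesz_product.
Context {R : realType} (q : nat) (a : R).
Context (mu : {finite_measure set (borel (torus R)) -> \bar R}).
Hypotheses (q3 : (3 <= q)%N) (a1 : -1 <= a <= 1) (mua : is_riesz_product a q mu).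
Local Notation g := (riesz_factor a).
Local Notation leb := (@lebesgue_measure R).

Let q0 : (0 < q)%N. Proof. exact: leq_trans q3. Qed.
Let q1 : (1 < q)%N. Proof. exact: leq_trans q3. Qed.
Let g_ge0 x : 0 <= g x. Proof. by have /andP[] := riesz_factor_bounds _ a1 x. Qed.

Lemma riesz_partialE (n : nat) (x : R) : riesz_partial a q n x = orbit_prod g q n.+1 x.
Proof.
rewrite /riesz_partial big_mkord; apply: eq_bigr => k _.
by rewrite /riesz_factor !mulrA.
Qed.

(** The case v = 1 with r = 1: g averages to 1 over preimages, so the mass stays below that of the
    empty product. *)
Lemma integral_orbit_prod_le1 (n : nat) :
  (\int[leb]_(x in `[0%R, 1%R[) (orbit_prod g q n x)%:E <= 1)%E.
Proof.
have := @integral_orbit_prod_le _ (cst 1) g q n 0 1 q0 (fun=> cvg_cst _)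
  (continuous_riesz_factor a) (fun=> ler01) g_ge0 (fun _ _ => erefl) (riesz_factor_int a).
rewrite addn0 expr1n mul1e.
under eq_integral do rewrite /(orbit_prod (cst _)) big1 ?mul1r//.
move=> h; apply: le_trans (h _ _) _.
  move=> y; under eq_bigr do rewrite mulr1.
  by rewrite sum_riesz_factor// mulVf// pnatr_eq0 -lt0n.
under eq_integral do rewrite /orbit_prod big_ord0.
rewrite integral_cst// mul1e.
by rewrite [leLHS]lebesgue_measure_itv/= lte_fin ltr01 oppr0 adde0.
Qed.

(** Passage to the weak limit: it suffices to bound the partial products having at least n
    factors. *)
Lemma riesz_product_integral_le (F : torus R -> R) (n : nat) (c : \bar R) :
  continuous F ->
  (forall N, (\int[leb]_(x in `[0%R, 1%R[)
     (F (to_torus x) * orbit_prod g q (n + N) x)%:E <= c)%E) ->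
  (\int[mu]_z (F z)%:E <= c)%E.
Proof.
move=> cF h; apply: (cvge_to_le (mua _ cF)).
(* [riesz_partial a q m] has m + 1 factors. *)
near=> m; have -> : (riesz_partial a q m = orbit_prod g q (n + (m.+1 - n)))%N.
  apply/funext => x; rewrite riesz_partialE subnKC//.
  by apply: leqW; near: m; exists n.
exact: h.
Unshelve. all: by end_near. Qed.

Lemma riesz_product_orbit_prod_le (v : R -> R) (n : nat) (r : R) :
  continuous v -> (forall x, 0 <= v x) -> (forall x (m : int), v (x + m%:~R) = v x) ->
  (forall y, q%:R^-1 * \sum_(j < q) g ((y + j%:R) / q%:R) * v ((y + j%:R) / q%:R) <= r) ->
  (\int[mu]_z (orbit_prod v q n (repr z)%qT)%:E <= (r ^+ n)%:E)%E.
Proof.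
move=> cv v0 vper avg.
have r0 : 0 <= r.
  apply: le_trans (avg 0); rewrite mulr_ge0 ?invr_ge0// sumr_ge0// => j _.
  by rewrite mulr_ge0.
apply: (@riesz_product_integral_le _ n).
  apply: continuous_lift => [|x m]; [exact: continuous_orbit_prod|exact: orbit_prod_int].
move=> N; under eq_integral => x _.
  have [m ->] := repr_to_torus x; rewrite orbit_prod_int//; over.
apply: le_trans (integral_orbit_prod_le _ _ _ _ _ _ q0 cv
  (continuous_riesz_factor a) v0 g_ge0 vper (riesz_factor_int a) avg) _.
rewrite -[leRHS]mule1 lee_wpmul2l ?lee_fin ?exprn_ge0//.
exact: integral_orbit_prod_le1.
Qed.

Local Notation W := (orbit_prod (fun x => g x + 2 * pi / q%:R) q).

(** For k < n the points q^k x and q^k y are within q^(k-n) <= 1 / q, and g is 2 pi-Lipschitz; this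
    is where the shift 2 pi / q in [W] comes from. *)
Lemma orbit_prod_riesz_factor_le (n : nat) (x y : R) : `|x - y| <= (q ^ n)%:R^-1 ->
  orbit_prod g q n x <= W n y.
Proof.
move=> xy; apply: ler_prod => k _; rewrite g_ge0/= -lerBlDl.
apply: le_trans (ler_norm _) (le_trans (riesz_factor_lipschitz _ a1 _ _) _).
rewrite ler_pM2l ?mulr_gt0 ?pi_gt0// -mulrBr normrM ger0_norm ?exprn_ge0//.
apply: le_trans (ler_wpM2l _ xy) _; first by rewrite exprn_ge0.
rewrite natrX ler_pdivrMr ?exprn_gt0 ?ltr0n// ler_pdivlMl ?ltr0n// -exprS.
by rewrite ler_weXn2l// ler1n.
Qed.

(** Bound the ball's indicator by a continuous tent function and apply the transfer inequality for Q
    = q^n, which separates the first n factors from the rest: on the support of the tent, those n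
    factors are at most W_n(x). *)
Lemma riesz_product_ball_le (n : nat) (x : R) :
  (mu ([set z : torus R | (mdist (to_torus x) z <= (2 * (q ^ n)%:R)^-1)%R]%classic
     : set (borel (torus R))) <=
   (4 / (q ^ n)%:R * W n x)%:E)%E.
Proof.
set Q := (q ^ n)%N; have Q0 : (0 < Q)%N by rewrite expn_gt0 q0.
have Q0' : 0 < Q%:R :> R by rewrite ltr0n.
(* A tent function of height 2 and radius 1 / Q: at most two points of a coset of
   (1 / Q) Z lie in its support. *)
pose F (z : torus R) : R := Num.max 0 (2 - 2 * Q%:R * mdist (to_torus x) z).
have F0 z : 0 <= F z by rewrite le_max lexx.
have cF : continuous F by exact: continuous_tent.
have W0 : 0 <= W n x.
  by apply: orbit_prod_ge0 => y; rewrite addr_ge0// divr_ge0// mulr_ge0// pi_ge0.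
pose B : set (borel (torus R)) :=
  [set z : torus R | (mdist (to_torus x) z <= (2 * Q%:R)^-1)%R]%classic.
change (mu B <= (4 / Q%:R * W n x)%:E)%E.
have mB : measurable (B : set (borel (torus R))).
  exact: (measurable_continuous_sublevel _ _ (continuous_mdist (to_torus x))).
apply: le_trans (measure_le_integral _ _ _ mB (continuous_measurable_borel _ cF) F0 _) _.
  move=> z zx; rewrite /F le_max; apply/orP; right.
  have : 2 * Q%:R * mdist (to_torus x) z <= 2 * Q%:R * (2 * Q%:R)^-1.
    by rewrite ler_pM2l// mulr_gt0.
  by rewrite mulfV ?mulf_neq0 ?gt_eqF//; lra.
apply: (@riesz_product_integral_le _ n) => //.
move=> N; under eq_integral do rewrite orbit_prodD mulrA.
rewrite -[leRHS]mule1.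
apply: (@le_trans _ _ ((4 / Q%:R * W n x)%:E *
    \int[leb]_(x in `[0%R, 1%R[) (orbit_prod g q N x)%:E)%E); last first.
  by rewrite lee_wpmul2l ?lee_fin ?mulr_ge0// ?integral_orbit_prod_le1.
apply: (@integral_transfer_le _ (fun y => F (to_torus y) * orbit_prod g q n y)
  (orbit_prod g q N)) => //.
- move=> y; apply: cvgM; last exact: continuous_orbit_prod (continuous_riesz_factor a) y.
  exact: (@continuous_comp _ _ _ (@to_torus R) F y (continuous_to_torus y) (cF _)).
- exact: continuous_orbit_prod (continuous_riesz_factor a).
- by move=> y; rewrite mulr_ge0 ?orbit_prod_ge0.
- by move=> y; rewrite orbit_prod_ge0.
- by move=> y m; apply: orbit_prod_int => *; exact: riesz_factor_int.
move=> y; rewrite -mulrA mulrCA ler_pM2l ?invr_gt0//.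
pose u := Num.floor (Q%:R * x - y).
(* The indicators mark the two residues that can meet the support; two residues times the height 2
   give the constant 4. *)
apply: (@le_trans _ _ (\sum_(j < Q) 2 * W n x *
    ((Posz j == (u %% Q)%Z)%:R + (Posz j == ((u + 1) %% Q)%Z)%:R))); last first.
  by rewrite -mulr_sumr big_split/= !sum_residue// -mulrA; lra.
apply: ler_sum => j _; set t := (y + _) / _.
have [d1|d1] := ltP (dist_int (x - t)) Q%:R^-1; last first.
  rewrite /F mdist_to_torus max_l.
    by rewrite mul0r mulr_ge0 ?addr_ge0// mulr_ge0.
  have := ler_pM2l Q0' Q%:R^-1 (dist_int (x - t)); rewrite d1 mulfV ?gt_eqF//; lra.
have F2 : F (to_torus t) <= 2.
  rewrite ge_max ler0n/= lerBlDr lerDl mulr_ge0 ?mdist_ge0// mulr_ge0//.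
have P1 : orbit_prod g q n t <= W n x.
  have [m xm] := dist_int_lt _ _ d1.
  rewrite -(orbit_prod_int g q n t (- m)); last exact: riesz_factor_int.
  apply: orbit_prod_riesz_factor_le; rewrite distrC rmorphN/=.
  by rewrite opprD opprK addrA ltW.
have /orP h := dist_int_grid _ Q j x y (ltn_ord j) d1.
have h1 : 1 <= (Posz j == (u %% Q)%Z)%:R + (Posz j == ((u + 1) %% Q)%Z)%:R :> R.
  by case: h => ->; rewrite ?lerDl ?lerDr.
apply: (@le_trans _ _ (2 * W n x)); first by apply: ler_pM => //; exact: orbit_prod_ge0.
by rewrite -[leLHS]mulr1 ler_wpM2l// mulr_ge0.
Qed.

End riesz_product.

(** * A mass distribution principle with exceptional sets *)

Section mass_distribution.
Local Open Scope classical_set_scope.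
Local Open Scope ring_scope.
Context {R : realType} (q : nat) (q1 : (1 < q)%N).

(** Take the least n >= N with 1 / (2 q^(n+1)) < r. Minimality, or the hypothesis on r when n = N,
    gives r <= 1 / (2 q^n). *)
Lemma geometric_scale_ge (N : nat) (r : R) : 0 < r -> r <= (2 * (q ^ N)%:R)^-1 ->
  exists2 n : nat, (N <= n)%N & r <= (2 * (q ^ n)%:R)^-1 /\ (q ^ n)%:R^-1 <= 2 * q%:R * r.
Proof.
move=> r0 rN; have qn0 n : 0 < (q ^ n)%:R :> R by rewrite ltr0n expn_gt0 (ltnW q1).
have q0 : 0 < q%:R :> R by rewrite ltr0n (ltnW q1).
pose P n := (N <= n)%N && ((2 * (q ^ n.+1)%:R)^-1 < r).
have exP : exists n, P n.
  pose m := maxn N (Num.truncn r^-1); exists m; rewrite /P leq_maxl/=.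
  rewrite invf_plt ?posrE ?mulr_gt0//.
  apply: lt_trans (truncnS_gt _) _.
  rewrite -natrM ltr_nat; apply: (@leq_ltn_trans (q ^ m)%N).
    by apply: leq_ltn_trans (ltn_expl m q1); rewrite leq_maxr.
  have h : (0 < q ^ m)%N by rewrite expn_gt0 (ltnW q1).
  by rewrite expnS mulnA ltn_Pmull// -[1%N]/(1 * 1)%N ltn_mul.
case: (ex_minnP exP) => n /andP[Nn nr] nmin; exists n => //; split.
  move: Nn; rewrite leq_eqVlt => /predU1P[<-//|Nn].
  rewrite leNgt; apply/negP => h; have n0 : (0 < n)%N by apply: leq_trans Nn.
  have := nmin n.-1; rewrite /P prednK// h andbT -ltnS prednK// Nn => /(_ isT).
  by rewrite leqNgt ltn_predL n0.
move: nr => /ltW; rewrite expnS natrM mulrA invfM ler_pdivrMl// mulr_gt0//.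
Qed.

(* The error [e] only serves the case [r = 0 < s], where [r `^ s = 0]. *)
Lemma geometric_scale (N : nat) (r s e : R) : 0 <= r -> 0 <= s -> 0 < e ->
  r <= (2 * (q ^ N)%:R)^-1 ->
  exists2 n : nat, (N <= n)%N & r <= (2 * (q ^ n)%:R)^-1 /\
    (q ^ n)%:R^-1 `^ s <= (2 * q%:R) `^ s * r `^ s + e.
Proof.
have qn0 n : 0 < (q ^ n)%:R :> R by rewrite ltr0n expn_gt0 (ltnW q1).
have q0 : 0 < q%:R :> R by rewrite ltr0n (ltnW q1).
rewrite le_eqVlt => /predU1P[<- s0 e0 _|r0 s0 e0 rN]; last first.
  have [n Nn [rn qn]] := geometric_scale_ge N r r0 rN; exists n => //; split => //.
  rewrite -powRM ?mulr_ge0// ?(ltW r0)//.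
  rewrite -[leLHS]addr0 lerD ?(ltW e0)// ge0_ler_powR// nnegrE ?invr_ge0 ?mulr_ge0//.
  exact: ltW.
(* For r = s = 0 both powers are 1, by the convention on the exponent 0. For s > 0 the right side is
   just e, and m is chosen with m s ln q >= |ln e|. *)
move: s0; rewrite le_eqVlt => /predU1P[<-|s0].
  exists N => //; split; first by rewrite invr_ge0 mulr_ge0.
  by rewrite !powRr0 mulr1 lerDl ltW.
have lnq : 0 < ln (q%:R : R) by rewrite ln_gt0// ltr1n.
pose m := maxn N (Num.truncn (`|ln e| / (s * ln q%:R))).+1.
exists m; rewrite ?leq_maxl//; split.
  by rewrite invr_ge0 mulr_ge0.
rewrite powR0 ?gt_eqF// mulr0 add0r -[leRHS]lnK ?posrE//.
rewrite -[leLHS]lnK ?posrE ?powR_gt0 ?invr_gt0//.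
rewrite ler_expR ln_powR lnV ?posrE// natrX lnXn// mulrN lerNl.
apply: (@le_trans _ _ `|ln e|); first by rewrite -normrN ler_norm.
rewrite mulrnAr -mulr_natl -ler_pdivrMr ?mulr_gt0//.
apply: ltW; apply: lt_le_trans (truncnS_gt _) _.
by rewrite ler_nat leq_maxr.
Qed.

Context (mu : {measure set (borel (torus R)) -> \bar R}).
Context (E : nat -> set (torus R)) (rho s C : R).
Hypotheses (s0 : 0 <= s) (C0 : 0 <= C) (rho01 : 0 <= rho < 1).
Hypothesis mE : forall n, measurable (E n : set (borel (torus R))).
Hypothesis muE : forall n, (mu (E n) <= (rho ^+ n)%:E)%E.
Hypothesis mu_ball : forall n (z : torus R), ~ E n z ->
  (mu ([set w | (mdist z w <= (2 * (q ^ n)%:R)^-1)%R] : set (torus R)) <=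
   (C * (q ^ n)%:R^-1 `^ s)%:E)%E.

(* Either [A] lies in some [E n], or a ball around a point of [A] outside [E n]
   covers [A]. *)
Lemma cover_piece (N : nat) (A : set (torus R)) (e : R) : 0 < e ->
  (diam A <= ((2 * (q ^ N)%:R)^-1)%:E)%E ->
  exists B : set (torus R), [/\ measurable (B : set (borel (torus R))),
    A `<=` B `|` \bigcup_(n in ~` `I_N) E n &
    (mu B <= (C * (2 * q%:R) `^ s)%:E * gauge s A + e%:E)%E].
Proof.
move=> e0 dA; have [->|/set0P[p Ap]] := eqVneq A set0.
  exists set0; split; [exact: measurable0|by move=> ?|].
  by rewrite measure0 adde_ge0 ?lee_fin ?(ltW e0)// /gauge eqxx mule0.
have A0 : (A == set0) = false by apply/negP => /eqP A0; move: Ap; rewrite A0.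
have diam_ge z w : A z -> A w -> ((mdist z w)%:E <= diam A)%E.
  by move=> Az Aw; apply: ereal_sup_ubound; exists z => //; exists w.
have d0 : (0 <= diam A)%E.
  by apply: le_trans (diam_ge p p Ap Ap); rewrite lee_fin mdist_ge0.
have dfin : diam A \is a fin_num by rewrite ge0_fin_numE// (le_lt_trans dA)// ltry.
pose r := fine (diam A); have rE : diam A = r%:E by rewrite fineK.
(* The scale error is multiplied by C in the ball estimate, and C e / (C + 1) <= e. *)
have e'0 : 0 < e / (C + 1) by rewrite divr_gt0// ltr_wpDl.
have [||n Nn [rn qn]] := geometric_scale N r s (e / (C + 1)) _ s0 e'0.
- by rewrite -lee_fin -rE.
- by rewrite -lee_fin -rE.
have gE : gauge s A = (r `^ s)%:E by rewrite /gauge A0 rE poweR_EFin.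
have [AE|/existsNP[z /not_implyP[Az nEz]]] := pselect (A `<=` E n).
  exists set0; split; [exact: measurable0| |].
    by move=> z /AE Ez; right; exists n => //=; apply/negP; rewrite -leqNgt.
  rewrite measure0 gE -EFinM -EFinD lee_fin addr_ge0 ?(ltW e0)// !mulr_ge0 ?powR_ge0//.
exists [set w | mdist z w <= (2 * (q ^ n)%:R)^-1]; split.
- exact: (measurable_continuous_sublevel _ _ (continuous_mdist z)).
- move=> w Aw; left => /=; apply: le_trans rn; rewrite -lee_fin -rE; exact: diam_ge.
apply: le_trans (mu_ball _ _ nEz) _; rewrite gE -EFinM -EFinD lee_fin.
apply: le_trans (ler_wpM2l C0 qn) _; rewrite mulrDr mulrA lerD2l.
rewrite mulrCA ler_piMr ?(ltW e0)// ler_pdivrMr ?ltr_wpDl// mul1r lerDl//.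
Qed.

(** Cover F at a scale d tied to a large N. The mass of F splits into three thirds of e: the tail of
    the [E n], bounded by a geometric series; the gauges of the pieces, times K; and the errors e /
    3 / 2^(i+1). *)
Lemma mass_distribution (F : set (torus R)) : measurable (F : set (borel (torus R))) ->
  hausdorff_measure s F = 0%E -> mu F = 0%E.
Proof.
move=> mF HF; have /andP[rho0 rho1] := rho01.
have rho1' : 0 < 1 - rho by rewrite subr_gt0.
apply/eqP; rewrite eq_le measure_ge0 andbT; apply/lee_addgt0Pr => e e0; rewrite add0e.
pose K := C * (2 * q%:R) `^ s.
have K0 : 0 <= K by rewrite mulr_ge0 ?powR_ge0.
have [N rhoN] : exists N, rho ^+ N / (1 - rho) <= e / 3.
  have := @cvg_geometric R (1 - rho)^-1 rho; rewrite ger0_norm// => /(_ rho1).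
  move=> /cvgrPdist_lt/(_ (e / 3)); rewrite divr_gt0// => /(_ isT).
  move=> [N _ /(_ N (leqnn N))] /=.
  rewrite sub0r normrN => /ltW h; exists N.
  by rewrite mulrC; apply: le_trans (ler_norm _) h.
pose d : R := (2 * (q ^ N)%:R)^-1.
have d0 : 0 < d by rewrite invr_gt0 mulr_gt0// ltr0n expn_gt0 (ltnW q1).
(* Zero Hausdorff measure makes the premeasure vanish at every scale; the threshold is such that K
   times it is at most e / 3. *)
have : (hausdorff_premeasure s d F < (e / 3 / (K + 1))%:E)%E.
  apply: (@le_lt_trans _ _ 0%E); last by rewrite lte_fin !divr_gt0// ltr_wpDl.
  by rewrite -HF; apply: ereal_sup_ubound; exists d.
move=> /ereal_inf_lt[_ [A [FA dA] <-] sumA].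
have e2 i : 0 < e / 3 / (2 ^ i.+1)%:R by rewrite !divr_gt0// ltr0n expn_gt0.
have [B BP] := choice (fun i => cover_piece N (A i) _ (e2 i) (dA i)).
pose tailE := \bigcup_(n in ~` `I_N) E n.
have mtail : measurable (tailE : set (borel (torus R))).
  by apply: bigcup_measurable => n _.
have mB i : measurable (B i : set (borel (torus R))) by have [] := BP i.
have mUB : measurable (\bigcup_i B i : set (borel (torus R))).
  exact: bigcupT_measurable.
have FU : F `<=` tailE `|` \bigcup_i B i.
  move=> z /FA[i _ Aiz]; have [_ /(_ z Aiz)[Bz|Ez] _] := BP i; [right|by left].
  by exists i.
apply: (@le_trans _ _ (mu tailE + mu (\bigcup_i B i))%E).
  apply: le_trans (measureU2 mu mtail mUB).
  by apply: le_measure; rewrite ?inE//; exact: measurableU.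
have -> : e%:E = ((e / 3)%:E + ((e / 3)%:E + (e / 3)%:E))%E.
  by rewrite -!EFinD; congr EFin; field.
apply: leeD.
  apply: le_trans (measure_sigma_subadditive_tail mu mE mtail (@subset_refl _ _)) _.
  apply: (@le_trans _ _ (\sum_(N <= n <oo) (rho ^+ n)%:E)%E).
    by apply: lee_nneseries => n _ //; exact: muE.
  apply: (cvge_to_le (is_cvg_nneseries (fun n _ _ => _))) => [n _ _|].
    by rewrite lee_fin exprn_ge0.
  near=> M; rewrite sumEFin lee_fin; apply: le_trans rhoN.
  have NM : (N <= M)%N by near: M; exists N.
  rewrite -(subnKC NM) geometric_partial_tail geometric_seriesE ?lt_eqF//=.
  by rewrite ler_pM2r ?invr_gt0// ler_piMr ?exprn_ge0// gerBl exprn_ge0.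
apply: le_trans (measure_sigma_subadditive mu mB mUB (@subset_refl _ _)) _.
apply: (@le_trans _ _ (\sum_(0 <= i <oo)
    (K%:E * gauge s (A i) + (e / 3 / (2 ^ i.+1)%:R)%:E))%E).
  by apply: lee_nneseries => i _ //; have [] := BP i.
have gauge0 i : (0 <= gauge s (A i))%E.
  by rewrite /gauge; case: ifP => // _; exact: poweR_ge0.
apply: le_trans (epsilon_trick _ _ _) _ => [i||].
- by rewrite mule_ge0.
- by rewrite divr_ge0// ltW.
rewrite leeD2r// nneseriesZl//.
apply: le_trans (lee_wpmul2l _ (ltW sumA)) _; first by rewrite lee_fin.
rewrite -EFinM lee_fin mulrCA ler_piMr ?divr_ge0 ?(ltW e0)//.
by rewrite ler_pdivrMr ?ltr_wpDl// mul1r lerDl.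
Unshelve. all: by end_near. Qed.

End mass_distribution.

(** * Null sets of the Riesz product and the dimension bound *)

(** The mass distribution principle applies with b = (1 - s) ln q: off the exceptional sets W_n <
    exp (n b) = q^(n (1 - s)), so balls have mass at most 4 (q^-n)^s. *)
Lemma riesz_product_null {R : realType} (q : nat) (a s : R)
  (mu : {finite_measure set (borel (torus R)) -> \bar R}) (F : set (torus R)) :
  (3 <= q)%N -> -1 <= a <= 1 -> is_riesz_product a q mu -> 0 <= s ->
  1 - ln 2 + 2 / (q - 2)%:R + 2 * pi / q%:R < (1 - s) * ln q%:R ->
  measurable (F : set (borel (torus R))) -> hausdorff_measure s F = 0%E -> mu F = 0%E.
Proof.
move=> q3 a1 mua s0 + mF HF; set d := 2 * pi / q%:R; set b := (_ * ln q%:R) => cb.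
have q1 : (1 < q)%N := leq_trans (isT : (1 < 3)%N) q3.
have q0 : 0 < q%:R :> R by rewrite ltr0n (ltnW q1).
have d0 : 0 < d by rewrite divr_gt0// mulr_gt0// pi_gt0.
have [t [rho [t0 rho1 avg]]] := riesz_factor_laplace a a1 q d b q3 d0 cb.
have g_ge0 y : 0 <= riesz_factor a y by have /andP[] := riesz_factor_bounds _ a1 y.
have gd_gt0 y : 0 < riesz_factor a y + d by rewrite ltr_wpDl.
pose W n x := orbit_prod (fun y => riesz_factor a y + d) q n x.
pose v y := expR (t * (ln (riesz_factor a y + d) - b)).
have vper y (m : int) : v (y + m%:~R) = v y by rewrite /v riesz_factor_int.
have cv : continuous v.
  move=> y; apply: (@continuous_comp _ _ _
    (fun y => t * (ln (riesz_factor a y + d) - b)) expR); last exact: continuous_expR.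
  apply: cvgMr; apply: cvgB; last exact: cvg_cst.
  apply: (@continuous_comp _ _ _ (fun y => riesz_factor a y + d) (@ln R)); last first.
    exact: continuous_ln.
  by apply: cvgD; [exact: continuous_riesz_factor|exact: cvg_cst].
have W_gt0 n x : 0 < W n x by apply: prodr_gt0.
have vW n x : orbit_prod v q n x = expR (t * (ln (W n x) - n%:R * b)).
  elim: n x => [|n IH] x.
    by rewrite /W /orbit_prod !big_ord0 ln1 mul0r subrr mulr0 expR0.
  rewrite orbit_prodS IH /W orbit_prodS -/(W _ _) lnM ?posrE// -expRD -natr1.
  by congr expR; ring.
(* The set where W_n >= exp (n b), put as a sublevel set of a continuous function for measurability;
   Markov's inequality bounds its mass by rho^n. *)
pose E n : set (torus R) := [set z | 1 - orbit_prod v q n (repr z)%qT <= 0]%classic.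
have cV n : continuous (fun z : torus R => orbit_prod v q n (repr z)%qT).
  apply: continuous_lift => [|x m]; [exact: continuous_orbit_prod|exact: orbit_prod_int].
have rho0 : 0 <= rho.
  apply: le_trans (avg 0); rewrite mulr_ge0 ?invr_ge0// sumr_ge0// => j _.
  by rewrite mulr_ge0// expR_ge0.
have mE n : measurable (E n : set (borel (torus R))).
  apply: (measurable_continuous_sublevel
    (fun z : torus R => 1 - orbit_prod v q n (repr z)%qT)).
  apply: (continuous_lift (fun x => 1 - orbit_prod v q n x)) => [x|x m]; last first.
    by rewrite orbit_prod_int.
  by apply: cvgB; [exact: cvg_cst|exact: continuous_orbit_prod].
apply: (@mass_distribution _ q q1 mu E rho s 4) => //.
- by rewrite rho0.
- move=> n; apply: le_trans (measure_le_integral _ _ _ (mE n)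
    (continuous_measurable_borel _ (cV n)) _ _) _.
  + by move=> z; apply: orbit_prod_ge0 => y; exact: expR_ge0.
  + by move=> z; rewrite /E/= subr_le0.
  + apply: (riesz_product_orbit_prod_le _ _ _ q3 a1 mua) => //.
    by move=> y; exact: expR_ge0.
- move=> n z; rewrite /E/= => /negP; rewrite -ltNge subr_gt0 vW => h.
  rewrite -{1}[z]to_torus_repr; move: (repr z) h => x h.
  apply: le_trans (riesz_product_ball_le _ _ _ q3 a1 mua n x) _.
  rewrite lee_fin -/d -/(W n x) -mulrA ler_pM2l//.
  have qn0 : 0 < (q ^ n)%:R :> R by rewrite ltr0n expn_gt0 (ltnW q1).
  have lnW : ln (W n x) <= n%:R * b.
    by move: h; rewrite expR_lt1 pmulr_rlt0// subr_lt0 => /ltW.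
  rewrite -[W n x]lnK ?posrE// -[(q ^ n)%:R^-1]lnK ?posrE ?invr_gt0// -expRD.
  rewrite -expRM ler_expR lnV ?posrE// natrX lnXn// -[ln _ *+ n]mulr_natl.
  have bE : n%:R * b = n%:R * ln q%:R - s * (n%:R * ln q%:R) by rewrite /b; ring.
  rewrite bE in lnW; lra.
Qed.

(** The triple angle formula at pi gives (c + 1) (2 c - 1)^2 = 0 with c > 0. *)
Lemma cos_pithird {R : realType} : cos (pi / 3) = 2^-1 :> R.
Proof.
have c0 : 0 < cos (pi / 3 : R).
  by have p0 := pi_gt0 R; apply: cos_gt0_pihalf; apply/andP; split; lra.
have : cos (pi / 3 + pi / 3 + pi / 3) = -1 :> R by rewrite -cospi; congr cos; field.
rewrite !cosD sinD; have := cos2Dsin2 (pi / 3 : R).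
move: (cos _) (sin _) c0 => c s c0 cs h.
have : (c + 1) * (2 * c - 1) ^+ 2 = 0.
  have -> : (c + 1) * (2 * c - 1) ^+ 2 =
      1 + ((c * c - s * s) * c - (s * c + c * s) * s) + 3 * c * (c ^+ 2 + s ^+ 2 - 1).
    by ring.
  by rewrite h cs; ring.
move/eqP; rewrite mulf_eq0 expf_eq0/= => /orP[/eqP|/eqP]; lra.
Qed.

(** For q >= 4, 2 / (q - 2) <= 4 / q <= 2 pi / q. For q = 3 the left side is 2, while 2 pi / 3 >= 4
    / 3 and the cosine term equals 1. *)
Lemma fourier_remainder_le {R : realType} (q : nat) : (3 <= q)%N ->
  2 / (q - 2)%:R <= 2 * pi / q%:R + (1 / cos (pi / q%:R) - 1) :> R.
Proof.
rewrite leq_eqVlt => /predU1P[<-|q4].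
  by rewrite cos_pithird subSS subSS subn0; have := pi_ge2 R; lra.
have q4' : 4 <= q%:R :> R by rewrite (ler_nat _ 4).
have q0 : 0 < q%:R :> R by lra.
have p2 := pi_ge2 R; have p0 := pi_gt0 R.
have c0 : 0 < cos (pi / q%:R : R).
  apply: cos_gt0_pihalf; apply/andP; split.
    by apply: (@lt_trans _ _ 0); [lra|rewrite divr_gt0].
  by rewrite ltr_pM2l// ltf_pV2 ?posrE//; lra.
have : 1 <= 1 / cos (pi / q%:R : R) by rewrite ler_pdivlMr// mul1r cos_le1.
have : 2 / (q - 2)%:R <= 2 * pi / q%:R :> R.
  rewrite ler_pdivlMr// mulrAC ler_pdivrMr ?natrB ?(ltnW (ltnW q4))//; last by lra.
  nra.
lra.
Qed.

Theorem proposition1p6 (R : realType) (q : nat) (a : R)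
  (mu : {finite_measure set (borel (torus R)) -> \bar R}) :
  (3 <= q)%N -> -1 <= a <= 1 -> is_riesz_product a q mu ->
  ((1 - (1 - ln 2) / ln q%:R - 4 * pi / (q%:R * ln q%:R)
      - 1 / ln q%:R * (1 / cos (pi / q%:R) - 1))%:E
    <= lower_hausdorff_dim mu)%E.
Proof.
move=> q3 a1 mua; set D := (X in (X%:E <= _)%E).
have q1 : (1 < q)%N := leq_trans (isT : (1 < 3)%N) q3.
have q0 : 0 < q%:R :> R by rewrite ltr0n (ltnW q1).
have lnq : 0 < ln (q%:R : R) by rewrite ln_gt0// ltr1n.
apply: le_ereal_inf_tmp => _ [alpha [F [mF muF dimF]] <-].
(* A set F of dimension below D would have zero s-dimensional measure for some s < D, hence zero
   mass. *)
rewrite leNgt; apply/negP => alphaD; move/eqP: muF; apply.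
have /ereal_inf_lt[_ [s [s0 HF] <-]] := le_lt_trans dimF alphaD.
rewrite lte_fin => sD.
apply: (riesz_product_null q a s mu F q3 a1 mua s0 _ mF HF).
(* Of 4 pi / q, one half pays for the shift in V; the other half and the cosine term pay for the
   Fourier remainder. *)
have DE : (1 - D) * ln q%:R = 1 - ln 2 + 4 * pi / q%:R + (1 / cos (pi / q%:R) - 1).
  by rewrite /D; move: (1 / cos _) => k; field; rewrite !gt_eqF.
have := fourier_remainder_le (R := R) q q3.
have : (1 - D) * ln q%:R < (1 - s) * ln q%:R by rewrite ltr_pM2r// ltrD2l ltrN2.
rewrite DE; lra.
Qed.
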